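(* Let $K=\mathbb{Q}(\sqrt{d})$ with $d>1$ a square-free positive integer. Then $K$ is unit reducible if and only if $d$ is of one of the following types: (T1) $d=m^2+1$ with $m\in\mathbb{N}$ odd; (T2) $d=m^2-1$ with $m\in\mathbb{N}$ even; (T3) $d=m^2+4$ with $m\in\mathbb{N}$ odd; (T4) $d=m^2-4$ with $m\in\mathbb{N}$ odd and $m>3$.
   Context: For a totally real number field $K$ with ring of integers $\mathcal{O}_K$ and unit group $\mathcal{O}_K^\times$, let $K_{>>0}$ be the set of totally positive elements and, for $a\in K_{>>0}$, $\mu(a)=\min_{x\in\mathcal{O}_K\setminus\{0\}}\mathrm{Tr}_{K/\mathbb{Q}}(ax^2)$. $K$ is called unit reducible if $\mu(a)=\min_{u\in\mathcal{O}_K^\times}\mathrm{Tr}_{K/\mathbb{Q}}(au^2)$ for all $a\in K_{>>0}$. *)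

(* Defs.v *)
(* The real quadratic field K = Q(sqrt d) is modelled by pairs
   (a, b) : rat * rat standing for a + b sqrt d; its two real embeddings land in
   algC (sqrtC is the nonnegative square root). *)
From mathcomp Require Import all_boot all_order all_algebra all_field.
Set Implicit Arguments. Unset Strict Implicit. Unset Printing Implicit Defensive.
Import Order.TTheory GRing.Theory Num.Theory.
Local Open Scope ring_scope.

Definition qf := (rat * rat)%type.

Definition qmul (d : nat) (x y : qf) : qf :=
  (x.1 * y.1 + d%:R * x.2 * y.2, x.1 * y.2 + x.2 * y.1).

Definition emb1 (d : nat) (x : qf) : algC := ratr x.1 + ratr x.2 * sqrtC d%:R.
Definition emb2 (d : nat) (x : qf) : algC := ratr x.1 - ratr x.2 * sqrtC d%:R.

Definition qtrace (d : nat) (x : qf) : algC := emb1 d x + emb2 d x.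

Definition totpos (d : nat) (x : qf) : Prop := 0 < emb1 d x /\ 0 < emb2 d x.

Definition in_OK (d : nat) (x : qf) : Prop := emb1 d x \in Aint.

Definition is_unit_OK (d : nat) (x : qf) : Prop :=
  in_OK d x /\ exists y : qf, in_OK d y /\ qmul d x y = (1, 0).

Definition squarefree (d : nat) : Prop :=
  forall p : nat, prime p -> ~~ (p * p %| d)%N.

Definition unit_reducible (d : nat) : Prop :=
  forall a : qf, totpos d a ->
    exists u : qf, is_unit_OK d u /\
      forall x : qf, in_OK d x -> x <> (0, 0) ->
        qtrace d (qmul d a (qmul d u u)) <= qtrace d (qmul d a (qmul d x x)).

(* Main.v *)
Require Import Defs.
From mathcomp Require Import all_boot all_order all_algebra all_field.
From mathcomp Require Import ring lra zify.
(* Let {1, omega} be the standard basis of O_K, s the coefficient of sqrt d in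
   omega, and D = 4 d s^2 the discriminant.

   If a is totally positive and a unit v minimises Tr (a v^2) over all nonzero
   integers, then w = a v^2 is such that Tr (w x^2) is minimal at x = 1, so
   Hermite's bound gives Tr(w)^2 <= (4/3) D N(w).  Applied to a = sqrt d e with
   e a unit of norm -1, or to a = u a totally positive unit, it forces the
   coordinate of the unit w / sqrt d, respectively w, on omega to be 0 or +-1.
   When it is +-1, the norm equation is one of the four types.  When it is 0,
   u is the square of a smaller unit, and one descends.

   Conversely, in each of the four types some e = k + omega is a unit, so that
   {1, e} is a basis of O_K.  After replacing a by a v^2 for a suitable unit v,
   Tr a is at most Tr (a e^2) and Tr (a e^-2), and these two inequalities
   already make Tr a the minimum of the form. *)
Set Implicit Arguments. Unset Strict Implicit. Unset Printing Implicit Defensive.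
Import Order.TTheory GRing.Theory Num.Theory.
Local Open Scope ring_scope.

(** * Square-free integers and squares of rationals *)

Lemma squarefree_eq1 (d c : nat) : squarefree d -> (c * c %| d)%N -> c = 1%N.
Proof.
move=> hsf hc; apply/eqP/negPn/negP => c1.
have /pdivP [p pp pc] : (1 < c)%N.
  case: c hc c1 => [|[|c]] //; rewrite mul0n dvd0n => /eqP d0 _.
  by have := hsf 2%N isT; rewrite d0.
by move: (hsf p pp); rewrite (dvdn_trans (dvdn_mul pc pc)).
Qed.

(** The square of the denominator divides d times the square of the numerator; by coprimality it
    divides d, so it is 1. *)
Lemma squarefree_sqr_int (d : nat) (y : rat) : squarefree d ->
  d%:R * y ^+ 2 \is a Num.int -> y \is a Num.int.
Proof.
move=> hsf /intrP [k hk]; rewrite Qint_def.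
have hd0 : (denq y)%:~R != 0 :> rat by rewrite intr_eq0 denq_neq0.
have e : d%:Z * numq y ^+ 2 = k * denq y ^+ 2.
  apply/eqP; rewrite -(eqr_int rat) !expr2 !intrM -hk -pmulrn.
  rewrite -{3}(divq_num_den y); apply/eqP.
  by field.
have e2 : (d * (`|numq y| * `|numq y|) = `|k| * (`|denq y| * `|denq y|))%N.
  by move/(congr1 absz): e; rewrite !abszM.
have : (`|denq y| * `|denq y| %| d)%N.
  rewrite -(@Gauss_dvdl _ _ (`|numq y| * `|numq y|)).
    by rewrite e2 dvdn_mull.
  by rewrite coprimeMl !coprimeMr coprime_sym coprime_num_den.
move/(squarefree_eq1 hsf) => h.
by have := denq_gt0 y; rewrite -[denq y]gtz0_abs ?denq_gt0 // h.
Qed.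

(** * Norm, conjugation, trace and total positivity in K *)

Section QuadraticIntegers.
Variable d : nat.
Implicit Types x y u v w a : qf.

Definition qnorm x : rat := x.1 ^+ 2 - d%:R * x.2 ^+ 2.
Definition qconj x : qf := (x.1, - x.2).

Lemma qnormM x y : qnorm (qmul d x y) = qnorm x * qnorm y.
Proof. by rewrite /qnorm /qmul /=; ring. Qed.

Lemma qmulA x y w : qmul d x (qmul d y w) = qmul d (qmul d x y) w.
Proof. by rewrite /qmul /=; congr pair; ring. Qed.

Lemma qmulC x y : qmul d x y = qmul d y x.
Proof. by rewrite /qmul /=; congr pair; ring. Qed.

Lemma qmul1 x : qmul d (1, 0) x = x.
Proof. by case: x => p q; rewrite /qmul /=; congr pair; ring. Qed.

Lemma qmul_conj x : qmul d x (qconj x) = (qnorm x, 0).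
Proof. by rewrite /qmul /qnorm /=; congr pair; ring. Qed.

Lemma emb1M x y : emb1 d (qmul d x y) = emb1 d x * emb1 d y.
Proof.
have h : sqrtC d%:R ^+ 2 = d%:R :> algC by rewrite sqrtCK.
rewrite /emb1 /qmul /= !(rmorphD, rmorphM) /= !ratr_nat.
by set s := sqrtC _ in h *; rewrite -h; ring.
Qed.

Lemma emb1_conj x : emb1 d (qconj x) = emb2 d x.
Proof. by rewrite /emb1 /emb2 /= rmorphN /= mulNr. Qed.

Lemma emb1_mul_emb2 x : emb1 d x * emb2 d x = ratr (qnorm x).
Proof.
by rewrite -emb1_conj -emb1M qmul_conj /emb1 /= rmorph0 mul0r addr0.
Qed.

Lemma qtraceE x : qtrace d x = ratr (2 * x.1).
Proof. by rewrite /qtrace /emb1 /emb2 rmorphM /= ratr_nat; ring. Qed.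

Lemma qtrace_le x y : (qtrace d x <= qtrace d y) = (x.1 <= y.1).
Proof. by rewrite !qtraceE ler_rat ler_pM2l. Qed.

Lemma emb1_real x : emb1 d x \is Num.real.
Proof.
have r (q : rat) : (ratr q : algC) \is Num.real by exact: Creal_Crat (Crat_rat q).
have rs : (sqrtC d%:R : algC) \is Num.real by apply: ger0_real; rewrite sqrtC_ge0 ler0n.
exact: realD (r _) (realM (r _) rs).
Qed.

(** Both embeddings are real, so the signs of their sum and product decide. This turns total
    positivity into inequalities between rationals. *)
Lemma totposP x : totpos d x <-> 0 < x.1 /\ 0 < qnorm x.
Proof.
have t : emb1 d x + emb2 d x = ratr (2 * x.1) by rewrite -qtraceE.
have n := emb1_mul_emb2 x.
split=> [[h1 h2]|[h1 h2]].
  have : 0 < emb1 d x + emb2 d x by rewrite addr_gt0.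
  have : 0 < emb1 d x * emb2 d x by rewrite mulr_gt0.
  by rewrite n t !ltr0q pmulr_rgt0.
have n0 : 0 < emb1 d x * emb2 d x by rewrite n ltr0q.
have t0 : 0 < emb1 d x + emb2 d x by rewrite t ltr0q mulr_gt0.
have pos (p q : algC) : 0 <= p -> 0 < p * q -> 0 < p /\ 0 < q.
  rewrite le_eqVlt => /orP[/eqP <-|p0]; first by rewrite mul0r ltxx.
  by rewrite pmulr_rgt0.
have := emb1_real x; rewrite realE => /orP[e1|e1]; first exact: pos.
have := emb1_real (qconj x); rewrite emb1_conj realE => /orP[e2|e2].
  by have [] := pos _ _ e2 (eq_ind _ (fun z => 0 < z) n0 _ (mulrC _ _)).
by have := lerD e1 e2; rewrite addr0 => /(lt_le_trans t0); rewrite ltxx.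
Qed.

Lemma emb1_eq0 x : (1 < d)%N -> squarefree d -> emb1 d x = 0 -> x = (0, 0).
Proof.
move=> hd hsf h.
have n0 : qnorm x = 0.
  by have := emb1_mul_emb2 x; rewrite h mul0r => /esym /eqP; rewrite fmorph_eq0 => /eqP.
have dn0 : d%:R != 0 :> rat by rewrite pnatr_eq0 -lt0n ltnW.
case: x h n0 => p q _; rewrite /qnorm /= => /eqP; rewrite subr_eq0 => /eqP e.
have [q0|q0] := eqVneq q 0.
  by move: e; rewrite q0 expr0n mulr0 => /eqP; rewrite expf_eq0 /= => /eqP ->.
(* A nonzero [q] makes [p / q / d] a rational square root of 1/d. It is then an integer k with d k^2
   = 1, against d > 1. *)
have : d%:R * (p / q / d%:R) ^+ 2 = 1.
  by rewrite !expr_div_n e; field; rewrite ?q0 ?dn0.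
move=> h1; have : p / q / d%:R \is a Num.int.
  by apply: (squarefree_sqr_int hsf); rewrite h1.
case/intrP => k hk; move: h1; rewrite hk -(rmorphXn intr) /= -[d%:R]/(d%:Z%:~R) -rmorphM /=.
move/(@intr_inj rat _ 1) => hz.
by move: hz hd; clear; case: k => k; nia.
Qed.

(** * The ring of integers, its basis and its units *)

Lemma in_OK_mul x y : in_OK d x -> in_OK d y -> in_OK d (qmul d x y).
Proof. by rewrite /in_OK emb1M => *; rewrite rpredM. Qed.

(** The minimal polynomial of the first embedding of x has integer coefficients; it remains to see
    that it kills the second embedding. Its remainder modulo X^2 - Tr(x) X + N(x) has degree at most
    1 and vanishes at the first embedding. An element of K with one embedding zero is zero, so the
    remainder vanishes at the second one too. *)
Lemma in_OK_conj x : (1 < d)%N -> squarefree d -> in_OK d x -> in_OK d (qconj x).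
Proof.
move=> hd hsf; rewrite /in_OK emb1_conj {1}/Aint unfold_in => hint.
apply: root_monic_Aint (minCpoly_monic (emb1 d x)) hint.
have [p [pQ _] _] := minCpolyP (emb1 d x).
have := root_minCpoly (emb1 d x); rewrite pQ.
have [n hn] : exists n, n = qnorm x by exists (qnorm x).
pose m : {poly rat} := 'X^2 - (2 * x.1) *: 'X + n%:P.
have mE (z : algC) : (map_poly (@ratr algC) m).[z] =
    z ^+ 2 - (emb1 d x + emb2 d x) * z + emb1 d x * emb2 d x :> algC.
  rewrite !(rmorphD, rmorphB, rmorphN) /= map_polyZ /= !map_polyC map_polyX map_polyXn /=.
  have := qtraceE x; rewrite /qtrace => ->.
  by rewrite !hornerE emb1_mul_emb2 hn.
have m1 : root (map_poly (@ratr algC) m) (emb1 d x) by rewrite /root mE; apply/eqP; ring.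
have m2 : root (map_poly (@ratr algC) m) (emb2 d x) by rewrite /root mE; apply/eqP; ring.
have [r [er sr]] : exists r, p = p %/ m * m + r /\ (size r <= 2)%N.
  exists (p %% m); split; first exact: divp_eq.
  have sm : (size m <= 3)%N.
    rewrite /m; apply: (leq_trans (size_polyD _ _)); rewrite geq_max.
    rewrite (leq_trans (size_polyC_leq1 _)) // andbT.
    apply: (leq_trans (size_polyD _ _)); rewrite geq_max size_polyXn size_polyN /=.
    by rewrite (leq_trans (size_scale_leq _ _)) // size_polyX.
  have [m0|m0] := eqVneq m 0; last by rewrite -ltnS (leq_trans (ltn_modpN0 _ m0)).
  have : m`_2 = 1.
    by rewrite !coefE /=; ring.
  by rewrite m0 coef0.
have rE (z : algC) : (map_poly (@ratr algC) r).[z] = ratr r`_0 + ratr r`_1 * z :> algC.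
  rewrite (@horner_coef_wide _ 2) ?size_map_poly // big_ord_recl big_ord1 !coef_map /=.
  by rewrite expr0 mulr1 expr1.
move: (p %/ m) er m1 m2 => q er; clearbody m => m1 m2.
have pE (z : algC) : root (map_poly (@ratr algC) m) z ->
    (map_poly (@ratr algC) p).[z] = ratr r`_0 + ratr r`_1 * z.
  by move/eqP => mz; rewrite er rmorphD rmorphM hornerD hornerM mz mulr0 add0r rE.
rewrite /root (pE _ m1) (pE _ m2) => /eqP h.
have : emb1 d (r`_0 + r`_1 * x.1, r`_1 * x.2) = 0.
  by rewrite -h /emb1 /= !rmorphD /= !rmorphM /=; ring.
move/(emb1_eq0 hd hsf) => [h1 h2].
have <- : emb2 d (r`_0 + r`_1 * x.1, r`_1 * x.2) = ratr r`_0 + ratr r`_1 * emb2 d x.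
  by rewrite /emb2 /= !rmorphD /= !rmorphM /=; ring.
by rewrite h1 h2 /emb2 /= rmorph0 mul0r subr0.
Qed.

(** Trace and norm are rational algebraic integers, hence integers. Conversely x is a root of X^2 -
    t X + n. *)
Lemma in_OKP_trace_norm x : (1 < d)%N -> squarefree d ->
  in_OK d x <-> 2 * x.1 \is a Num.int /\ qnorm x \is a Num.int.
Proof.
move=> hd hsf; split=> [h|[/intrP [t ht] /intrP [n hn]]].
  have h' := in_OK_conj hd hsf h; rewrite /in_OK emb1_conj in h'.
  split; rewrite -Cint_rat; apply: Cint_rat_Aint; rewrite ?Crat_rat //.
    by rewrite -qtraceE rpredD.
  by rewrite -emb1_mul_emb2 rpredM.
pose m : {poly algC} := 'X^2 - t%:~R *: 'X + (n%:~R)%:P.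
have sm : (size (- (t%:~R *: 'X) + (n%:~R)%:P : {poly algC})%R < 3)%N.
  rewrite ltnS (leq_trans (size_polyD _ _)) // geq_max size_polyN.
  rewrite (leq_trans (size_scale_leq _ _)) ?size_polyX //.
  by rewrite (leq_trans (size_polyC_leq1 _)).
apply: (@root_monic_Aint m).
- have := qtraceE x; rewrite ht ratr_int /qtrace => ht'.
  have := emb1_mul_emb2 x; rewrite hn ratr_int => hn'.
  by rewrite /root /m !hornerE -ht' -hn'; apply/eqP; ring.
- by rewrite /m -addrA monicE lead_coefDl ?size_polyXn // lead_coefXn.
- apply/polyOverP => i; rewrite !coefE rpredD ?rpredB ?rpredM ?rpred_nat ?intr_int //.
  by case: ifP => _; rewrite ?intr_int ?rpred0.
Qed.

Definition omega : qf := if (d %% 4 == 1)%N then (1 / 2, 1 / 2) else (0, 1).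

Lemma squarefree_mod4 : squarefree d -> (d %% 4 != 0)%N.
Proof. by move=> /(_ 2%N isT). Qed.

Lemma intr_inj_rat (i j : int) : i%:~R = j%:~R :> rat -> i = j.
Proof. exact: intr_inj. Qed.

(** Put t = 2 x.1 and s = 2 x.2. Then s is an integer because d s^2 = t^2 - 4 N(x), and t^2 - d s^2
    is divisible by 4. This forces t and s to have the same parity if d is 1 mod 4, and both to be
    even if d is 2 or 3 mod 4. *)
Lemma in_OKP x : (1 < d)%N -> squarefree d ->
  in_OK d x <->
  exists i j : int, x = (i%:~R + j%:~R * omega.1, j%:~R * omega.2).
Proof.
move=> hd hsf; have h4 := squarefree_mod4 hsf.
rewrite in_OKP_trace_norm //; split=> [[/intrP [t ht] /intrP [n hn]]|[i [j ->]]].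
  have [s hs] : exists s : int, 2 * x.2 = s%:~R.
    apply/intrP; apply: (squarefree_sqr_int hsf).
    have -> : d%:R * (2 * x.2) ^+ 2 = (2 * x.1) ^+ 2 - 4 * qnorm x.
      by rewrite /qnorm; ring.
    by rewrite ht hn rpredB ?rpredM ?rpredX ?intr_int.
  have e : t * t - d%:Z * (s * s) = 4 * n.
    apply: intr_inj_rat; rewrite !(rmorphB, rmorphM) /= -hn -ht -hs /qnorm -pmulrn; ring.
  have x1 : x.1 = t%:~R / 2 by rewrite -ht; field.
  have x2 : x.2 = s%:~R / 2 by rewrite -hs; field.
  have par (z : int) : exists z', z = 2 * z' \/ z = 2 * z' + 1.
    exists (z %/ 2)%Z; lia.
  have [k [r [dE r4]]] : exists k r : nat, d = (4 * k + r)%N /\ r = (d %% 4)%N.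
    by exists (d %/ 4)%N, (d %% 4)%N; split=> //; lia.
  have [t' ht'] := par t; have [s' hs'] := par s.
  have r3 : (r < 4)%N by lia.
  rewrite /omega -r4; case: eqP => [r1|r1].
    have [i hi] : exists i, t = s + 2 * i.
      subst r; rewrite r1 in dE; rewrite dE in e.
      by case: ht' hs' e => -> [] -> e; [exists (t' - s')| | |exists (t' - s')]; lia.
    exists i, s; rewrite [x]surjective_pairing x1 x2 hi /=.
    by rewrite rmorphD rmorphM /=; congr pair; field.
  have [i [j [hi hj]]] : exists i j, t = 2 * i /\ s = 2 * j.
    exists t', s'; rewrite -r4 in h4.
    have [r2|r2] : r = 2%N \/ r = 3%N by move: r3 h4 r1; clear; lia.
      rewrite r2 in dE; rewrite dE in e; clear -ht' hs' e.
      by case: ht' hs' e => -> [] -> e; lia.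
    rewrite r2 in dE; rewrite dE in e; clear -ht' hs' e.
    by case: ht' hs' e => -> [] -> e; lia.
  exists i, j; rewrite [x]surjective_pairing x1 x2 hi hj /=.
  by rewrite !rmorphM /=; congr pair; field.
rewrite /omega; case: eqP => r1 /=; last first.
  have nE : qnorm (i%:~R + j%:~R * 0, j%:~R * 1) = (i * i - d%:Z * (j * j))%:~R.
    by rewrite /qnorm /= !(rmorphB, rmorphM) /= -pmulrn; ring.
  by rewrite nE mulr0 addr0 rpredM ?intr_int.
have [k dE] : exists k : nat, d = (4 * k + 1)%N by exists (d %/ 4)%N; lia.
have nE : qnorm (i%:~R + j%:~R * (1 / 2), j%:~R * (1 / 2)) = (i * i + i * j - k%:Z * (j * j))%:~R.
  have dQ : d%:R = 4 * k%:Z%:~R + 1 :> rat by rewrite dE natrD natrM.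
  by rewrite /qnorm dQ /= !(rmorphB, rmorphM, rmorphD) /=; field.
rewrite nE intr_int; split=> //.
have -> : 2 * (i%:~R + j%:~R * (1 / 2)) = (2 * i + j)%:~R :> rat.
  by rewrite rmorphD rmorphM /=; field.
exact: intr_int.
Qed.

Lemma is_unitP u : (1 < d)%N -> squarefree d ->
  is_unit_OK d u <-> in_OK d u /\ (qnorm u = 1 \/ qnorm u = -1).
Proof.
move=> hd hsf; split.
  case=> [hu [y [hy uy]]]; split=> //.
  have := congr1 qnorm uy; rewrite qnormM.
  have [_ /intrP [n ->]] := (in_OKP_trace_norm u hd hsf).1 hu.
  have [_ /intrP [m ->]] := (in_OKP_trace_norm y hd hsf).1 hy.
  rewrite /qnorm /= expr0n mulr0 subr0 expr1n -rmorphM => /(@intr_inj_rat _ 1) nm.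
  have : (n == 1) || (n == -1).
    move/(congr1 absz)/eqP: nm; rewrite abszM muln_eq1 => /andP[/eqP h _].
    by lia.
  by case/orP => /eqP ->; [left|right]; rewrite ?rmorphN.
case=> hu hn; split=> //; have cu := in_OK_conj hd hsf hu.
have uc := qmul_conj u.
case: hn => hn; rewrite hn in uc; first by exists (qconj u).
(* For norm -1 the inverse is minus the conjugate. *)
exists (- u.1, u.2); split.
  have -> : (- u.1, u.2) = qmul d (-1, 0) (qconj u).
    by rewrite /qmul /=; congr pair; ring.
  apply: in_OK_mul cu; rewrite /in_OK /emb1 /= rmorphN rmorph1 rmorph0 mul0r addr0.
  by rewrite rpredN Aint1.
rewrite /qmul /=; congr pair; last by ring.
by rewrite -[RHS]opprK -hn /qnorm; ring.
Qed.

End QuadraticIntegers.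

(** * Lower bounds for reduced binary forms *)

Section UnitReducibility.
Variable d : nat.
Implicit Types x y u v w a : qf.

(** For N = -1 the mixed term vanishes. For N = 1 the difference of the two sides is (t - 4)(i^2 +
    j^2 - 1) + 4 (i^2 + i j + j^2 - 1), with both terms nonnegative once 4 <= t. *)
Lemma binary_form_ge (t N i j : int) :
  N = 1 /\ 4 <= t \/ N = -1 /\ 1 <= t -> (i, j) <> (0, 0) ->
  t <= t * (i ^+ 2 + j ^+ 2) + 2 * (1 + N) * (i * j).
Proof.
move=> hN ij0.
have h0 : 1 <= i ^+ 2 + j ^+ 2.
  have [i0|i0] := eqVneq i 0; last by nia.
  have [j0|j0] := eqVneq j 0; last by nia.
  by case: ij0; rewrite i0 j0.
case: hN => -[-> ht]; last by nia.
have h1 : 1 <= i ^+ 2 + j ^+ 2 + i * j.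
  by have [i0|i0] := eqVneq i 0; nia.
have h2 : 0 <= i ^+ 2 + j ^+ 2 - 1 by lia.
have := mulr_ge0 (_ : 0 <= t - 4) h2; nia.
Qed.

(* The form is affine in B, and at the two extreme values of B allowed by the
   hypotheses it becomes, up to a change of variables, the form of
   binary_form_ge. *)
Lemma reduced_form_ge (A B : rat) (t N i j : int) :
  N = 1 /\ 4 <= t \/ N = -1 /\ 1 <= t -> (i, j) <> (0, 0) -> 0 <= A ->
  A <= t%:~R * B - N%:~R * A ->
  A <= t%:~R ^+ 2 * A - t%:~R * B - N%:~R * A ->
  A <= A * i%:~R ^+ 2 + 2 * B * (i%:~R * j%:~R) + (t%:~R * B - N%:~R * A) * j%:~R ^+ 2.
Proof.
move=> hN ij0 A0 lo hi.
have t0 : 0 < t%:~R :> rat by rewrite ltr0z; case: hN => -[_]; lia.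
have bnd k l : (k, l) <> (0, 0) ->
    0 <= t%:~R * (k%:~R ^+ 2 + l%:~R ^+ 2) + 2 * (1 + N%:~R) * (k%:~R * l%:~R) - t%:~R :> rat.
  move=> kl0; have := binary_form_ge hN kl0.
  rewrite -(ler_int rat) !(rmorphD, rmorphM, rmorphXn) /= => h.
  by rewrite subr_ge0.
rewrite -(ler_pM2l t0) -subr_ge0.
(* Up to the factor t, [c] is the coefficient of [B] in the inequality multiplied by t; its sign
   tells which extreme value of [B] is the worst case. *)
pose c : rat := 2 * (i%:~R * j%:~R) + t%:~R * j%:~R ^+ 2.
have [c0|c0] := leP 0 c.
  rewrite [X in 0 <= X](_ : _ = A * (t%:~R * (i%:~R ^+ 2 + j%:~R ^+ 2)
     + 2 * (1 + N%:~R) * (i%:~R * j%:~R) - t%:~R)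
     + (t%:~R * B - N%:~R * A - A) * c); last by rewrite /c; ring.
  by rewrite addr_ge0 // mulr_ge0 ?bnd ?subr_ge0 //.
(* If e has trace t and conjugate e', then -(i + j e) = -(i + t j) + j e'. This change of variables
   exchanges the two bounds on [B]. *)
rewrite [X in 0 <= X](_ : _ = A * (t%:~R * ((- (i + t * j))%:~R ^+ 2 + j%:~R ^+ 2)
     + 2 * (1 + N%:~R) * ((- (i + t * j))%:~R * j%:~R) - t%:~R)
     + (t%:~R ^+ 2 * A - t%:~R * B - N%:~R * A - A) * - c); last first.
  by rewrite /c rmorphN rmorphD rmorphM /=; ring.
rewrite addr_ge0 // mulr_ge0 ?bnd ?subr_ge0 ?oppr_ge0 ?(ltW c0) //.
by case=> z0 j0; apply: ij0; rewrite j0 mulr0 addr0 in z0 *; congr pair; lia.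
Qed.

(** * Descent along units, and sufficiency of the four types *)

Lemma totpos_mul a v : (0 < d)%N -> totpos d a -> qnorm d v != 0 ->
  totpos d (qmul d a (qmul d v v)).
Proof.
move=> d0; rewrite !totposP => -[a1 na] nv; rewrite !qnormM; split; last first.
  by rewrite mulr_gt0 // -expr2 exprn_even_gt0.
rewrite -(pmulr_rgt0 _ a1).
(* Completing the square: both terms are nonnegative, and they do not vanish together. *)
rewrite (_ : a.1 * _ = (a.1 * v.1 + d%:R * a.2 * v.2) ^+ 2 + d%:R * qnorm d a * v.2 ^+ 2);
  last by rewrite /qnorm /qmul /=; ring.
have [v20|v20] := eqVneq v.2 0.
  rewrite v20 mulr0 addr0 expr0n mulr0 addr0 exprn_even_gt0 //= mulf_neq0 //.
    by rewrite gt_eqF.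
  by move: nv; rewrite /qnorm v20 expr0n mulr0 subr0 expf_eq0.
by rewrite ltr_wpDl ?sqr_ge0 // mulr_gt0 ?exprn_even_gt0 // mulr_gt0 ?ltr0n.
Qed.

(** The values of the trace form lie in a discrete set, which makes descent on them terminate. *)
Lemma trace_denominator a : (1 < d)%N -> squarefree d ->
  exists2 M : nat, (0 < M)%N & forall x, in_OK d x -> M%:R * (qmul d a x).1 \is a Num.int.
Proof.
move=> hd hsf.
exists (2 * (`|denq a.1| * `|denq a.2|))%N; first by rewrite !muln_gt0 !absz_gt0 !denq_neq0.
move=> x hx.
have [/intrP [t ht] _] := (in_OKP_trace_norm x hd hsf).1 hx.
have [s hs] : exists s : int, 2 * x.2 = s%:~R.
  apply/intrP; have [i [j ->]] := (in_OKP x hd hsf).1 hx.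
  rewrite /omega; case: ifP => _ /=; last by rewrite !rpredM ?intr_int.
  by rewrite (_ : 2 * _ = j%:~R) ?intr_int //; field.
have den (q : rat) : `|denq q|%:R = (denq q)%:~R :> rat.
  by rewrite -[in RHS](gtz0_abs (denq_gt0 q)).
have h1 := numqE a.1; have h2 := numqE a.2.
rewrite !natrM !den [X in X \is a _](_ : _ = (numq a.1)%:~R * (denq a.2)%:~R * t%:~R
   + d%:R * (numq a.2)%:~R * (denq a.1)%:~R * s%:~R).
  by rewrite rpredD ?rpredM ?intr_int ?rpred_nat.
by rewrite -ht -hs h1 h2 /qmul /=; ring.
Qed.

(** Strong induction on the natural number M Tr(a v^2) / 2: as long as multiplying v by e or its
    conjugate lowers it, move there. *)
Lemma unit_descent a e : (1 < d)%N -> squarefree d -> totpos d a -> is_unit_OK d e ->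
  exists v, [/\ is_unit_OK d v,
    (qmul d a (qmul d v v)).1 <= (qmul d (qmul d a (qmul d v v)) (qmul d e e)).1 &
    (qmul d a (qmul d v v)).1 <= (qmul d (qmul d a (qmul d v v)) (qmul d (qconj e) (qconj e))).1].
Proof.
move=> hd hsf ha; rewrite is_unitP // => -[he ne].
have [M M0 hM] := trace_denominator a hd hsf.
pose f v := (qmul d a (qmul d v v)).1.
have normU v : qnorm d v = 1 \/ qnorm d v = -1 -> qnorm d v != 0.
  by case=> ->; rewrite ?oppr_eq0 oner_eq0.
suff gen n v : is_unit_OK d v -> M%:R * f v = n%:R -> exists v, [/\ is_unit_OK d v,
    f v <= f (qmul d v e) & f v <= f (qmul d v (qconj e))].
  have u1 : is_unit_OK d (1, 0).
    apply/is_unitP => //; split; last by left; rewrite /qnorm /= expr0n mulr0 subr0 expr1n.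
    by rewrite /in_OK /emb1 /= rmorph1 rmorph0 mul0r addr0 Aint1.
  have /intrP [n hn] : M%:R * f (1, 0) \is a Num.int.
    by apply: hM; rewrite qmul1; case: u1.
  have n0 : 0 <= n.
    rewrite -(ler_int rat) -hn mulr_ge0 ?ler0n //; apply: ltW.
    have nz : qnorm d (1, 0) != 0 by apply: normU; left; rewrite /qnorm /= expr0n mulr0 subr0 expr1n.
    by have /totposP [] := totpos_mul (ltnW hd) ha nz.
  have [|v [hv h1 h2]] := gen `|n|%N (1, 0) u1.
    by rewrite hn -{1}(gez0_abs n0).
  have E w : qmul d (qmul d a (qmul d v v)) (qmul d w w) =
      qmul d a (qmul d (qmul d v w) (qmul d v w)).
    by rewrite /qmul /=; congr pair; ring.
  by exists v; split; rewrite ?E.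
elim/ltn_ind: n v => n IH v hv hn.
have step w : is_unit_OK d w -> f v <= f (qmul d v w) \/ exists v, [/\ is_unit_OK d v,
    f v <= f (qmul d v e) & f v <= f (qmul d v (qconj e))].
  rewrite is_unitP // => -[hw nw]; have [|lt] := leP (f v) (f (qmul d v w)); first by left.
  move: hv; rewrite is_unitP // => -[hv nv].
  have hvw : is_unit_OK d (qmul d v w).
    apply/is_unitP => //; split; first exact: in_OK_mul.
    by rewrite qnormM; case: nv => ->; case: nw => ->; rewrite ?mulr1 ?mul1r ?mulrNN ?mulr1; auto.
  have /intrP [m hm] : M%:R * f (qmul d v w) \is a Num.int.
    by apply: hM; case: hvw => h _; apply: in_OK_mul.
  have m0 : 0 <= m.
    rewrite -(ler_int rat) -hm mulr_ge0 ?ler0n //; apply: ltW.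
    have nz : qnorm d (qmul d v w) != 0 by rewrite qnormM mulf_neq0 ?normU.
    by have /totposP [] := totpos_mul (ltnW hd) ha nz.
  right; apply: (IH `|m|%N _ _ hvw); last by rewrite hm -{1}(gez0_abs m0).
  rewrite -ltz_nat gez0_abs // -(ltr_int rat) -hm -pmulrn -hn ltr_pM2l ?ltr0n //.
have [] := step e; [exact/is_unitP| |by []] => h1.
have [] := step (qconj e); [|by move=> h2; exists v|by []].
apply/is_unitP => //; split; first exact: in_OK_conj.
by rewrite /qnorm /= sqrrN.
Qed.

(** In the basis {1, e}, with b = a v^2 from the descent, the trace form is the one of
    [reduced_form_ge] for A = b.1 and B = (b e).1. Since e^2 = t e - N, the two descent inequalities
    are its two hypotheses on [B]. *)
Lemma generator_unit_reducible (k t : int) : (1 < d)%N -> squarefree d ->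
  let e : qf := (k%:~R + (omega d).1, (omega d).2) in
  2 * e.1 = t%:~R ->
  (qnorm d e = 1 /\ 4 <= t) \/ (qnorm d e = -1 /\ 1 <= t) -> unit_reducible d.
Proof.
move=> hd hsf e te hN a ha.
have he : in_OK d e by apply/in_OKP => //; exists k, 1; rewrite !mul1r.
have [N hN' hN''] : exists2 N : int, qnorm d e = N%:~R & N = 1 /\ 4 <= t \/ N = -1 /\ 1 <= t.
  by case: hN => -[-> ht]; [exists 1|exists (-1)]; auto.
have ue : is_unit_OK d e by apply/is_unitP => //; split=> //; case: hN => -[]; auto.
have [v [hv lo hi]] := unit_descent hd hsf ha ue.
exists v; split=> // x hx x0.
have /is_unitP [//|//|hv' nv] := hv.
have nv0 : qnorm d v != 0 by case: nv => ->; rewrite ?oppr_eq0 oner_eq0.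
rewrite qtrace_le.
(* Up to sign, [y] is x / v, so a x^2 = b y^2. *)
pose y := qmul d (qconj v) x.
have hy : in_OK d y by apply: in_OK_mul => //; exact: in_OK_conj.
have vy : qmul d v y = (qnorm d v * x.1, qnorm d v * x.2).
  by rewrite /y /qnorm /qmul /=; congr pair; ring.
have nv2 : qnorm d v ^+ 2 = 1 by case: nv => ->; rewrite ?sqrrN expr1n.
set b := qmul d a (qmul d v v) in lo hi *.
have -> : (qmul d a (qmul d x x)).1 = (qmul d b (qmul d y y)).1.
  transitivity ((qmul d a (qmul d (qmul d v y) (qmul d v y))).1); last first.
    by rewrite /b /qmul /=; ring.
  by rewrite vy -[LHS]mul1r -nv2 /qmul /=; ring.
have [i [j yE]] : exists i j : int, y = (i%:~R + j%:~R * e.1, j%:~R * e.2).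
  have [i [j ->]] := (in_OKP y hd hsf).1 hy.
  exists (i - j * k), j; rewrite /e /= rmorphB rmorphM /=; congr pair; ring.
have ij0 : (i, j) <> (0, 0).
  case=> i0 j0; apply: x0; rewrite i0 j0 !mul0r addr0 in yE.
  move: vy; rewrite yE /qmul /= !mulr0 !addr0 => -[] /esym/eqP h1 /esym/eqP h2.
  move: h1 h2; rewrite !mulf_eq0 (negbTE nv0) /=.
  by case: (x) => p q /= /eqP -> /eqP ->.
have /totposP [b0 _] : totpos d b by apply: totpos_mul => //; exact: ltnW.
have := @reduced_form_ge b.1 (qmul d b e).1 t N i j hN'' ij0 (ltW b0).
rewrite -te -hN' => red.
rewrite yE [X in _ <= X](_ : _ = b.1 * i%:~R ^+ 2 + 2 * (qmul d b e).1 * (i%:~R * j%:~R) +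
       (2 * e.1 * (qmul d b e).1 - qnorm d e * b.1) * j%:~R ^+ 2);
  last by rewrite /qnorm /qmul /=; ring.
apply: red.
  by apply: (le_trans lo); rewrite le_eqVlt; apply/orP; left; apply/eqP; rewrite /qnorm /qmul /=; ring.
by apply: (le_trans hi); rewrite le_eqVlt; apply/orP; left; apply/eqP; rewrite /qnorm /qmul /=; ring.
Qed.

Lemma omega_mod1 : (d %% 4 = 1)%N -> omega d = (1 / 2, 1 / 2).
Proof. by rewrite /omega => ->. Qed.

Lemma omega_modN1 : (d %% 4 != 1)%N -> omega d = (0, 1).
Proof. by rewrite /omega => /negbTE ->. Qed.

Definition reducible_type : Prop :=
  (exists m : nat, odd m /\ d = (m ^ 2 + 1)%N) \/
  (exists m : nat, ~~ odd m /\ d = (m ^ 2 - 1)%N) \/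
  (exists m : nat, odd m /\ d = (m ^ 2 + 4)%N) \/
  (exists m : nat, odd m /\ (3 < m)%N /\ d = (m ^ 2 - 4)%N).

(** The unit is m + sqrt d in the first two types, and (m + sqrt d) / 2 = (m - 1) / 2 + omega in the
    last two. The norm is -1, 1, -1, 1 respectively; in the fourth type m > 3 gives the required
    trace at least 4. *)
Lemma types_unit_reducible : (1 < d)%N -> squarefree d ->
  reducible_type -> unit_reducible d.
Proof.
move=> hd hsf [[m [om dE]]|[[m [om dE]]|[[m [om dE]]|[m [om [m3 dE]]]]]].
- have o : omega d = (0, 1) by apply: omega_modN1; have : odd m by []; nia.
  apply: (@generator_unit_reducible m (2%:Z * m%:Z)) => //; rewrite o /=.
    by rewrite addr0 intrM.
  right; split; last by case: (m) om => //; lia.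
  by rewrite /qnorm /= dE natrD natrX -pmulrn; ring.
- have o : omega d = (0, 1) by apply: omega_modN1; have : ~~ odd m by []; nia.
  have m1 : (1 < m)%N by case: (m) dE hd => [|[|]] //= ->.
  apply: (@generator_unit_reducible m (2%:Z * m%:Z)) => //; rewrite o /=.
    by rewrite addr0 intrM.
  left; split; last by lia.
  by rewrite /qnorm /= dE natrB ?natrX -?pmulrn ?expn_gt0 ?(ltnW m1) //; ring.
- have o : omega d = (1 / 2, 1 / 2) by apply: omega_mod1; nia.
  have mE : m = (2 * m./2 + 1)%N by lia.
  have mQ : m%:R = 2 * (m./2)%:R + 1 :> rat by rewrite [in LHS]mE natrD natrM.
  apply: (@generator_unit_reducible m./2 m) => //; rewrite o /=.
    by rewrite -!pmulrn mQ; field.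
  right; split; last by case: (m) om => //; lia.
  by rewrite /qnorm /= dE natrD natrX mQ -pmulrn; field.
have o : omega d = (1 / 2, 1 / 2) by apply: omega_mod1; nia.
have mE : m = (2 * m./2 + 1)%N by lia.
have mQ : m%:R = 2 * (m./2)%:R + 1 :> rat by rewrite [in LHS]mE natrD natrM.
apply: (@generator_unit_reducible m./2 m) => //; rewrite o /=.
  by rewrite -!pmulrn mQ; field.
left; split; last by lia.
rewrite /qnorm /= dE natrB ?natrX ?mQ -?pmulrn; first by field.
by rewrite (@leq_exp2r 2 m 2) // ltnW // ltnW.
Qed.

(** * Hermite's bound at a minimising unit *)

Lemma omega2_gt0 : 0 < (omega d).2.
Proof. by rewrite /omega; case: ifP. Qed.

(* Tested at k + omega with k the best integer, minimality at 1 gives Hermite's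
   bound on the first minimum of the form x |-> Tr (w x^2). *)
Lemma minimal_at_one_bound w : (1 < d)%N -> squarefree d -> 0 < w.1 ->
  (forall x, in_OK d x -> x <> (0, 0) -> w.1 <= (qmul d w (qmul d x x)).1) ->
  3 * w.1 ^+ 2 <= 4 * d%:R * (omega d).2 ^+ 2 * qnorm d w.
Proof.
move=> hd hsf w0 wmin; have s0 := omega2_gt0.
set s := (omega d).2 in s0 *; set h := (omega d).1.
(* Completing the square at k + omega produces (k + c)^2; [k] is an integer nearest to -c, so |k +
   c| <= 1/2. *)
pose c := h + d%:R * w.2 * s / w.1.
pose k : int := - Num.floor (c + 1 / 2).
have hk : (k%:~R + c) ^+ 2 <= 1 / 4.
  have := floor_itv (c + 1 / 2); rewrite intrD -[Num.floor _]opprK -/k rmorphN /= mulr1z.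
  move: (k%:~R : rat) => K /andP[h1 h2].
  have : 0 <= (K + c + 1 / 2) * (1 / 2 - (K + c)) by rewrite mulr_ge0 //; lra.
  by move: (K + c) => z; lra.
have hx : in_OK d (k%:~R + h, s) by apply/in_OKP => //; exists k, 1; rewrite !mul1r.
have x0 : (k%:~R + h, s) <> (0, 0) by case=> _ e; rewrite e ltxx in s0.
have := wmin _ hx x0; rewrite -(ler_pM2l w0).
rewrite [X in _ <= X](_ : _ = w.1 ^+ 2 * (k%:~R + c) ^+ 2 + d%:R * qnorm d w * s ^+ 2); last first.
  by rewrite /c /qnorm /qmul /=; field; rewrite gt_eqF.
move=> h1; have := ler_wpM2l (sqr_ge0 w.1) hk; lra.
Qed.

Lemma qmul_eq0 v x : qnorm d v != 0 -> qmul d v x = (0, 0) -> x = (0, 0).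
Proof.
move=> nv h; have : qmul d (qconj v) (qmul d v x) = (0, 0).
  by rewrite h /qmul /= !mulr0 addr0.
rewrite qmulA (qmulC _ (qconj v)) qmul_conj /qmul /= !mul0r !addr0 mulr0 mul0r addr0.
by case: x {h} => p q /= [/eqP + /eqP]; rewrite !mulf_eq0 (negbTE nv) /= => /eqP -> /eqP ->.
Qed.

(** Multiplication by the minimising unit v preserves nonzero integers, so minimality at v for a
    becomes minimality at 1 for a v^2, whose norm is that of a. *)
Lemma unit_minimizer_bound a : (1 < d)%N -> squarefree d ->
  unit_reducible d -> totpos d a ->
  exists v, let w := qmul d a (qmul d v v) in
    [/\ is_unit_OK d v, 0 < w.1, qnorm d w = qnorm d a
      & 3 * w.1 ^+ 2 <= 4 * d%:R * (omega d).2 ^+ 2 * qnorm d a].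
Proof.
move=> hd hsf ur ha; have [v [uv vmin]] := ur a ha; exists v => /=.
have /is_unitP [//|//|hv nv] := uv.
have nv0 : qnorm d v != 0 by case: nv => ->; rewrite ?oppr_eq0 oner_eq0.
have nw : qnorm d (qmul d a (qmul d v v)) = qnorm d a.
  by rewrite !qnormM; case: nv => ->; ring.
have /totposP [w0 _] := totpos_mul (ltnW hd) ha nv0.
split=> //; rewrite -nw; apply: minimal_at_one_bound => // x hx x0.
have := vmin (qmul d v x) (in_OK_mul hv hx) (fun e => x0 (qmul_eq0 nv0 e)).
by rewrite qtrace_le; congr (_ <= _); rewrite /qmul /=; ring.
Qed.

(** * Existence of a nontrivial unit *)

Lemma sqrt_floor : (1 < d)%N -> squarefree d ->
  exists k : nat, (k ^ 2 < d < k.+1 ^ 2)%N.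
Proof.
move=> hd hsf; suff [k /andP[h1 h2]] : exists k, (k ^ 2 <= d < k.+1 ^ 2)%N.
  exists k; rewrite h2 andbT ltn_neqAle h1 andbT; apply/eqP => e.
  have k1 : k = 1%N by apply: (squarefree_eq1 hsf); rewrite mulnn e.
  by move: hd; rewrite -e k1.
elim: d => [|n [k /andP[h1 h2]]]; first by exists 0%N.
have [h|h] := ltnP n.+1 (k.+1 ^ 2)%N; first by exists k; rewrite h leqW.
by exists k.+1; rewrite h; nia.
Qed.

(* For a functional weighing heavily on the first embedding, sqrt d - k beats
   every rational unit; this yields a nontrivial unit without Pell's theorem. *)
Lemma unit_reducible_nontrivial_unit : (1 < d)%N -> squarefree d ->
  unit_reducible d -> exists2 u, is_unit_OK d u & u.2 != 0.
Proof.
move=> hd hsf ur; have [k /andP[kd dk]] := sqrt_floor hd hsf.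
have k0 : (0 < k)%N by case: (k) dk => //; lia.
have [c [dE c1 c2]] : exists c : nat, [/\ d = (k ^ 2 + c)%N, (0 < c)%N & (c <= 2 * k)%N].
  by exists (d - k ^ 2)%N; split; nia.
pose D : rat := d%:R; pose K : rat := k%:R; pose C : rat := c%:R.
have DE : D = K ^+ 2 + C by rewrite /D dE natrD natrX.
have K1 : 1 <= K by rewrite /K ler1n.
have C1 : 1 <= C by rewrite /C ler1n.
have C2 : C <= 2 * K by rewrite /C /K -natrM ler_nat.
(* For a = r + sqrt d and x = -K + sqrt d, half of Tr(a x^2) is r (K^2 + D) - 2 D K. It is below r,
   the value at 1 and -1, exactly when r < R. Room for such an r above sqrt d comes from S^2 < 4 D
   K^2, that is (C - 1)^2 < 4 K^2. *)
pose S := K ^+ 2 + D - 1; have S0 : 0 < S by rewrite /S DE; nra.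
have D0 : 0 < D by rewrite DE; nra.
pose R := 2 * D * K / S; have R0 : 0 < R by rewrite /R divr_gt0 ?mulr_gt0 //; lra.
have SS : S ^+ 2 < 4 * D * K ^+ 2 by rewrite /S DE; nra.
have RD : D < R ^+ 2.
  rewrite /R expr_div_n ltr_pdivlMr ?exprn_gt0 //.
  by rewrite (_ : (2 * D * K) ^+ 2 = D * (4 * D * K ^+ 2)) ?ltr_pM2l //; ring.
(* A Newton step for sqrt D from R gives a rational strictly between sqrt D and R. *)
pose r := (R + D / R) / 2.
have r0 : 0 < r by rewrite /r divr_gt0 // addr_gt0 // divr_gt0.
have rR : r < R.
  have : D / R < R by rewrite ltr_pdivrMr.
  by rewrite /r; lra.
have rD : D < r ^+ 2.
  rewrite -subr_gt0 (_ : r ^+ 2 - D = ((R - D / R) / 2) ^+ 2).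
    rewrite exprn_even_gt0 //= mulf_neq0 ?invr_eq0 // subr_eq0 gt_eqF //.
    by rewrite ltr_pdivrMr.
  by rewrite /r; field; rewrite gt_eqF.
have rS : r * S < 2 * D * K.
  by rewrite -ltr_pdivlMr.
have ha : totpos d (r, 1) by apply/totposP; rewrite /qnorm /= expr1n mulr1 subr_gt0.
have [u [uu umin]] := ur _ ha; exists u => //; apply/eqP => u2.
have hx : in_OK d (- K, 1).
  apply/in_OKP_trace_norm => //; rewrite /qnorm /=.
  by rewrite !(rpredB, rpredM, rpredX, rpredN, rpred_nat, rpred1).
have x0 : (- K, 1 : rat) <> (0, 0) by [].
have := umin _ hx x0; rewrite qtrace_le.
have /is_unitP [//|//|_ nu] := uu.
have u1 : u.1 ^+ 2 = 1.
  move: nu; rewrite /qnorm u2 expr0n mulr0 subr0 => -[] // h.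
  by have := sqr_ge0 u.1; rewrite h.
rewrite /qmul /= -/D u2 !(mulr0, mul0r, addr0, mul1r, mulr1) -expr2 u1.
by rewrite leNgt => /negP; apply; move: rS; rewrite /S; lra.
Qed.

(** * Necessity: from units to the four types *)

Lemma neg_norm_unit_type u : (1 < d)%N -> squarefree d -> unit_reducible d ->
  in_OK d u -> qnorm d u = -1 -> reducible_type.
Proof.
move=> hd hsf ur hu nu; have h4 := squarefree_mod4 hsf.
have D0 : 0 < d%:R :> rat by rewrite ltr0n ltnW.
wlog u2 : u hu nu / 0 < u.2.
  move=> H; have [u2|u2|u2] := ltrgtP 0 u.2; first exact: (H u).
    by apply: (H (qconj u)); [exact: in_OK_conj|rewrite -nu /qnorm /= sqrrN|rewrite /= oppr_gt0].
  by have := sqr_ge0 u.1; move: nu; rewrite /qnorm -u2 expr0n mulr0 subr0 => ->.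
(* This is u sqrt d, of norm d; [u.2 > 0] makes it totally positive. *)
pose a : qf := (d%:R * u.2, u.1).
have na : qnorm d a = d%:R by rewrite -[RHS]opprK -[in RHS]mulrN1 -nu /qnorm /=; ring.
have ha : totpos d a by apply/totposP; rewrite na mulr_gt0.
have [v [uv + _]] := unit_minimizer_bound hd hsf ur ha; rewrite na.
have /is_unitP [//|//|hv nv] := uv.
pose g := qmul d u (qmul d v v).
have -> : (qmul d a (qmul d v v)).1 = d%:R * g.2 by rewrite /g /qmul /=; ring.
have ng : qnorm d g = -1 by rewrite /g !qnormM nu; case: nv => ->; ring.
have [i [j gE]] : exists i j : int, g = (i%:~R + j%:~R * (omega d).1, j%:~R * (omega d).2).
  by apply/in_OKP => //; rewrite /g; do 2?apply: in_OK_mul.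
have s0 := omega2_gt0.
rewrite pmulr_rgt0 // gE /= pmulr_lgt0 // ltr0z => j0 bnd.
(* Hermite's bound reduces to 3 j^2 <= 4, and j > 0. *)
have j1 : j = 1.
  have : 3 * j%:~R ^+ 2 <= 4 :> rat.
    rewrite -(ler_pM2l (_ : 0 < d%:R ^+ 2 * (omega d).2 ^+ 2)); last by rewrite mulr_gt0 ?exprn_gt0.
    by move: bnd; apply: etrans; congr (_ <= _); ring.
  rewrite -(rmorphXn intr) -(rmorphM intr 3) /= (ler_int rat _ 4); nia.
move: ng; rewrite gE j1 /qnorm /= !mul1r; case: (eqVneq (d %% 4)%N 1%N) => r1.
  rewrite omega_mod1 //= => ng; right; right; left; exists `|(2 * i + 1)%R|%N.
  suff e : (2 * i + 1) ^+ 2 = d%:Z - 4 by split; nia.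
  apply: (@intr_inj rat); rewrite rmorphXn rmorphB rmorphD rmorphM /= -pmulrn; lra.
rewrite omega_modN1 //= => ng; left; exists `|i|%N.
(* An even [i] would put d in the class 1 mod 4, so [i] is odd. *)
suff e : i ^+ 2 = d%:Z - 1 by split; nia.
by apply: (@intr_inj rat); rewrite rmorphXn rmorphB /= -pmulrn; lra.
Qed.

(** Strong induction on the trace [n]: either Hermite's bound yields a type at once, or u is the
    square of a unit to which the induction or the norm -1 case applies. *)
Lemma pos_norm_unit_type (n : nat) u : (1 < d)%N -> squarefree d -> unit_reducible d ->
  in_OK d u -> qnorm d u = 1 -> u.2 != 0 -> 2 * u.1 = n%:R -> reducible_type.
Proof.
move=> hd hsf ur; have h4 := squarefree_mod4 hsf.
have D0 : 0 < d%:R :> rat by rewrite ltr0n ltnW.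
have s0 := omega2_gt0.
elim/ltn_ind: n u => n IH u hu nu u20 un.
have u10 : 0 < u.1.
  have : 0 <= 2 * u.1 by rewrite un ler0n.
  rewrite pmulr_rge0 // le_eqVlt => /orP[/eqP e|//].
  have := mulr_ge0 (ltW D0) (sqr_ge0 u.2).
  by move: nu; rewrite /qnorm -e expr0n /=; lra.
have ha : totpos d u by apply/totposP; rewrite nu.
have [v [uv + + bnd]] := unit_minimizer_bound hd hsf ur ha; move: bnd; rewrite nu mulr1.
have /is_unitP [//|//|hv nv] := uv.
set w := qmul d u (qmul d v v) => bnd w0 nw.
have [i [j wE]] : exists i j : int, w = (i%:~R + j%:~R * (omega d).1, j%:~R * (omega d).2).
  by apply/in_OKP => //; rewrite /w; do 2?apply: in_OK_mul.
have w1E : w.1 ^+ 2 = 1 + d%:R * w.2 ^+ 2 by move: nw; rewrite /qnorm; lra.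
(* Inserting w.1^2 = 1 + d j^2 s^2, where s is the second coordinate of omega, into Hermite's bound
   gives 3 j^2 < 4. *)
have j1 : j ^+ 2 <= 1.
  have : 3 * j%:~R ^+ 2 < 4 :> rat.
    rewrite -(ltr_pM2l (_ : 0 < d%:R * (omega d).2 ^+ 2)); last by rewrite mulr_gt0 ?exprn_gt0.
    by move: bnd; rewrite w1E wE /=; lra.
  rewrite -(rmorphXn intr) -(rmorphM intr 3) /= (ltr_int rat _ 4); lia.
have [j0|j0] := eqVneq j 0.
  have w2 : w.2 = 0 by rewrite wE j0 /= mul0r.
  have w1 : w.1 = 1.
    move: w1E; rewrite w2 expr0n mulr0 addr0 => /eqP; rewrite sqrf_eq1 => /orP[/eqP //|/eqP e].
    by move: w0; rewrite e.
  case: nv => nv; last exact: neg_norm_unit_type nv.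
  (* Here u v^2 = 1 and v has norm 1, so its conjugate is its inverse. *)
  have uE : u = qmul d (qconj v) (qconj v).
    transitivity (qmul d w (qmul d (qconj v) (qconj v))).
      transitivity (qnorm d v ^+ 2 * u.1, qnorm d v ^+ 2 * u.2).
        by rewrite nv expr1n !mul1r; case: (u).
      by rewrite /w /qnorm /qmul /=; congr pair; ring.
    by rewrite [w]surjective_pairing w1 w2 qmul1.
  have v20 : v.2 != 0 by apply: contra u20 => /eqP e; rewrite uE /qmul /= e; apply/eqP; ring.
  have uT : n%:R = (2 * v.1) ^+ 2 - 2.
    rewrite -un uE /qmul /=; have := nv; rewrite /qnorm; lra.
  have [/intrP [t ht] _] := (in_OKP_trace_norm v hd hsf).1 hv.
  have t2 : 4 < t ^+ 2.
    rewrite -(ltr_int rat) rmorphXn /= -ht.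
    have : 0 < d%:R * v.2 ^+ 2 by rewrite mulr_gt0 // exprn_even_gt0.
    by have := nv; rewrite /qnorm; lra.
  (* As t^2 > 4, this exceeds |t|, so the trace drops; v is replaced by -v when t < 0. *)
  have nt : n%:Z = t ^+ 2 - 2.
    by apply: (@intr_inj rat); rewrite rmorphB rmorphXn /= -ht -uT.
  have [t0|t0] := leP 0 t.
    apply: (IH `|t|%N _ v) => //; first by nia.
    by rewrite ht -{1}(gez0_abs t0).
  apply: (IH `|t|%N _ (- v.1, - v.2)) => /=; first by nia.
  - by rewrite /in_OK /emb1 /= !rmorphN mulNr -opprD rpredN.
  - by rewrite -nv /qnorm /= !sqrrN.
  - by rewrite oppr_eq0.
  by rewrite mulrN ht -rmorphN -{1}(ltz0_abs t0).
have {}j1 : j = 1 \/ j = -1 by nia.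
have jj : j%:~R ^+ 2 = 1 :> rat by case: j1 => ->; rewrite ?rmorphN ?sqrrN expr1n.
move: w1E; rewrite wE /= exprMn jj mul1r; case: (eqVneq (d %% 4)%N 1%N) => r1.
  rewrite omega_mod1 //= => nE.
  have e : (2 * i + j) ^+ 2 = d%:Z + 4.
    apply: (@intr_inj rat); rewrite rmorphXn !rmorphD rmorphM /= -pmulrn; lra.
  have [m3|m3] := ltnP 3 `|(2 * i + j)%R|.
    by right; right; right; exists `|(2 * i + j)%R|%N; split; [|split=> //]; nia.
  (* The remaining case |2 i + j| = 3 gives d = 5 = 3^2 - 4, which the fourth type excludes but
     which is 1^2 + 4. *)
  right; right; left; exists 1%N; split=> //.
  have : (`|(2 * i + j)%R| <= 3)%N by []. nia.
rewrite omega_modN1 //= mulr0 addr0 => nE; right; left; exists `|i|%N.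
have e : i ^+ 2 = d%:Z + 1.
  by apply: (@intr_inj rat); rewrite rmorphXn rmorphD /= -pmulrn; lra.
by split; nia.
Qed.

Lemma unit_reducible_type : (1 < d)%N -> squarefree d -> unit_reducible d -> reducible_type.
Proof.
move=> hd hsf ur; have [u uu u2] := unit_reducible_nontrivial_unit hd hsf ur.
have /is_unitP [//|//|hu [nu|nu]] := uu; last exact: neg_norm_unit_type nu.
have [/intrP [t ht] _] := (in_OKP_trace_norm u hd hsf).1 hu.
have [t0|t0] := leP 0 t.
  by apply: (@pos_norm_unit_type `|t|%N u) => //; rewrite ht -{1}(gez0_abs t0).
apply: (@pos_norm_unit_type `|t|%N (- u.1, - u.2)) => //=.
- by rewrite /in_OK /emb1 /= !rmorphN mulNr -opprD rpredN.
- by rewrite -nu /qnorm /= !sqrrN.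
- by rewrite oppr_eq0.
by rewrite mulrN ht -rmorphN -{1}(ltz0_abs t0).
Qed.

End UnitReducibility.

Theorem theorem4 (d : nat) (hd : (1 < d)%N) (hsf : squarefree d) :
  unit_reducible d <->
  ((exists m : nat, odd m /\ d = (m ^ 2 + 1)%N) \/
   (exists m : nat, ~~ odd m /\ d = (m ^ 2 - 1)%N) \/
   (exists m : nat, odd m /\ d = (m ^ 2 + 4)%N) \/
   (exists m : nat, odd m /\ (3 < m)%N /\ d = (m ^ 2 - 4)%N)).
Proof.
split; first exact: unit_reducible_type.
exact: types_unit_reducible.
Qed.
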